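(* Let $M$ be an oriented Riemannian 4-manifold, let $f:S_M\to M$ be its unit tangent sphere bundle with the metric described in the context, and let $\phi=\alpha+\mu\wedge\beta-\alpha_2\in\Omega^3(S_M)$ be the canonical $G_2$ structure 3-form. Then all the fibres $f^{-1}(x)$, $x\in M$, are associative: the restriction of $\phi$ to each fibre is exactly the volume form of the fibre.
   Context: Setting. $(M,\langle\,,\rangle)$ is an oriented smooth Riemannian 4-manifold with Levi-Civita connection $\nabla$ and volume form $\mathrm{Vol}_M$. $S_M=\{u\in TM:\ \|u\|=1\}$ and $f:S_M\to M$ is the projection. Let $U$ be the tautological section of $f^*TM\to S_M$, $U_u=u$. The vertical bundle $\mathcal V=\ker \mathrm{d}f$ is identified with the subbundle $U^\perp\subset f^*TM$, i.e. $\mathcal V_u=u^\perp\subset T_{f(u)}M$. The Levi-Civita connection gives a splitting $TS_M=\mathcal V\oplus\mathcal H^\nabla$, with $\mathcal H^\nabla=\{X\in TS_M:\ (f^*\nabla)_XU=0\}$, and $\mathcal H^\nabla$ is identified with $f^*TM$ via $\mathrm{d}f$. Write $X=X^v+X^h$ for the decomposition of a vector; $X^v=(f^*\nabla)_XU$. The metric on $S_M$ makes $\mathcal V\perp\mathcal H^\nabla$ and restricts to $f^*\langle\,,\rangle$ on each of $\mathcal H^\nabla\cong f^*TM$ and $\mathcal V\subset f^*TM$. Each fibre $f^{-1}(x)$ is the unit sphere $S^3$ of $T_xM$, with the induced metric, and is oriented as the boundary of the unit ball of the oriented space $T_xM$ (outward normal first): a basis $v_1,v_2,v_3$ of $u^\perp$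 is direct iff $u,v_1,v_2,v_3$ is direct in $T_xM$. Let $\theta$ be the map $\mathcal H^\nabla\to f^*TM$ given by $\mathrm{d}f$ (regarded as taking values in the copy of $f^*TM$ that contains $\mathcal V$), extended by $0$ on $\mathcal V$. Let $e_0=\theta^tU\in\mathcal H^\nabla$ be the horizontal vector field with $\theta e_0=U$. Adapted frames: complete $e_0$ locally to an orthonormal frame $e_0,e_1,e_2,e_3$ of $\mathcal H^\nabla$, direct for the orientation of $M$, and set $e_{i+3}=\theta e_i\in\mathcal V$ for $i=1,2,3$. With dual coframe $e^0,\dots,e^6$ and $e^{ij\cdots}=e^i\wedge e^j\wedge\cdots$, the following are globally defined forms on $S_M$ (independent of the adapted frame): $\mu=e^0$, i.e. $\mu(X)=\langle U,\theta X\rangle$; $\beta=e^{14}+e^{25}+e^{36}$, i.e. $\beta(X,Y)=\langle\theta X,Y^v\rangle-\langle\theta Y,X^v\rangle$; $\alpha=e^{456}$, i.e. $\alpha(X,Y,Z)=\mathrm{Vol}_M(U,X^v,Y^v,Z^v)$; $\alpha_2=e^{126}+e^{234}+e^{315}$. The form $\phi=\alpha+\mu\wedge\beta-\alpha_2$ defines a $G_2$ structure on $S_M$ inducing the metric on $S_M$ for which $\mathcal V\perp\mathcal H^\nabla$ and which restricts to $f^*\langle\,,\rangle$ on each of $\mathcal H^\nabla\cong f^*TM$ and $\mathcal V\subset f^*TM$. *)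

(* Defs.v *)
From HB Require Import structures.
From mathcomp Require Import all_boot all_order all_algebra.
From mathcomp Require Import all_classical all_reals all_analysis.

Set Implicit Arguments.
Unset Strict Implicit.
Unset Printing Implicit Defensive.

Import Order.TTheory GRing.Theory Num.Theory.
Import numFieldNormedType.Exports.

Local Open Scope classical_set_scope.
Local Open Scope ring_scope.

(** * Smooth manifolds

   Tangent vectors are represented as follows: every point [x] has a preferred
   chart [chart_at A x] containing it, and [T_x M] is identified with the model
   space [E] by taking components in that chart. The tangent bundle is then
   [M * E] as a set; its charts, and the passage from one chart to another, are
   given by the derivatives of the transition maps. *)

(* C^k on an open set of a finite-dimensional space: f is differentiable and
   all its directional derivatives are C^(k-1). *)
Fixpoint Ck (R : realType) (V W : normedModType R) (k : nat) (D : set V)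
    (f : V -> W) : Prop :=
  match k with
  | 0 => forall x, D x -> {for x, continuous f}
  | k'.+1 => (forall x, D x -> differentiable f x) /\
             (forall v, Ck k' D (fun x => 'd f x v))
  end.

Definition smooth_on (R : realType) (V W : normedModType R) (D : set V)
    (f : V -> W) : Prop := forall k, Ck k D f.

(* [chart_param i] is meant to be the inverse of [chart_coord i]; the requirements are in
   [smooth_manifold] below. *)
Record atlas (R : realType) (E : normedModType R) (M : Type) := Atlas {
  chart_index : Type;
  chart_dom : chart_index -> set M;
  chart_coord : chart_index -> M -> E;
  chart_param : chart_index -> E -> M;
  chart_at : M -> chart_index
}.
Arguments chart_dom {R E M}.
Arguments chart_coord {R E M}.
Arguments chart_param {R E M}.
Arguments chart_at {R E M}.

Section Manifolds.
Variables (R : realType) (E : normedModType R).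

Definition transition (M : Type) (A : atlas E M) (i j : chart_index A) : E -> E :=
  chart_coord A j \o chart_param A i.

Record smooth_manifold (M : topologicalType) (A : atlas E M) : Prop := {
  sm_hausdorff : hausdorff_space M;
  sm_second_countable : @second_countable M;
  sm_chart_at : forall x, chart_dom A (chart_at A x) x;
  sm_open_dom : forall i, open (chart_dom A i);
  sm_open_image : forall i, open (chart_coord A i @` chart_dom A i);
  sm_coordK : forall i x, chart_dom A i x -> chart_param A i (chart_coord A i x) = x;
  sm_coord_continuous : forall i x, chart_dom A i x ->
    {for x, continuous (chart_coord A i)};
  sm_param_continuous : forall i y, (chart_coord A i @` chart_dom A i) y ->
    {for y, continuous (chart_param A i)};
  sm_transition : forall i j,
    smooth_on (chart_coord A i @` (chart_dom A i `&` chart_dom A j)) (transition i j)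
}.

(* Differential at [x] of a map to a normed space. *)
Definition vdiff (M : Type) (A : atlas E M) (W : normedModType R)
    (h : M -> W) (x : M) : E -> W :=
  'd (h \o chart_param A (chart_at A x)) (chart_coord A (chart_at A x) x).

(* Differential at [x] of a map between manifolds, [T_x M -> T_(h x) N]. *)
Definition tangent_map (M : Type) (A : atlas E M) (F : normedModType R)
    (N : Type) (B : atlas F N) (h : M -> N) (x : M) : E -> F :=
  vdiff A (chart_coord B (chart_at B (h x)) \o h) x.

Section TangentBundle.
Variables (M : Type) (A : atlas E M).

(* Components in the chart [i], at the point of coordinates [y], to components
   in the preferred chart of that point. *)
Definition to_preferred (i : chart_index A) (y : E) : E -> E :=
  'd (transition i (chart_at A (chart_param A i y))) y.

(* Components of [v : T_x M] in the chart [i]. *)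
Definition components (i : chart_index A) (x : M) (v : E) : E :=
  'd (transition (chart_at A x) i) (chart_coord A (chart_at A x) x) v.

Definition tangent_atlas : atlas (E * E)%type (M * E)%type := {|
  chart_index := chart_index A;
  chart_dom := fun i => [set u | chart_dom A i u.1];
  chart_coord := fun i u => (chart_coord A i u.1, components i u.1 u.2);
  chart_param := fun i p => (chart_param A i p.1, to_preferred i p.1 p.2);
  chart_at := fun u => chart_at A u.1
|}.

End TangentBundle.

(** * Riemannian metrics and the Levi-Civita connection *)

Section Riemannian.
Variables (M : Type) (A : atlas E M) (g : M -> E -> E -> R).

Definition local_metric (i : chart_index A) (y a b : E) : R :=
  g (chart_param A i y) (to_preferred i y a) (to_preferred i y b).

Record riemannian_metric : Prop := {
  rm_linear : forall x (k : R) a a' b,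
    g x (k *: a + a') b = k * g x a b + g x a' b;
  rm_sym : forall x a b, g x a b = g x b a;
  rm_pos : forall x a, a != 0 -> 0 < g x a a;
  rm_smooth : forall i a b,
    smooth_on (chart_coord A i @` chart_dom A i) (fun y => local_metric i y a b)
}.

(* [Gamma i y a b] is the vector of components
   [\sum_(j, k) Gamma_(j k) a_j b_k] of the Christoffel symbols in the chart [i]
   at the point of coordinates [y]: in this chart
   [nabla_a V = 'd V y a + Gamma i y a (V y)]. The symbols of a connection which
   is torsion-free and makes the metric parallel are unique, so smoothness and
   the change-of-chart law need not be required. *)
Record levi_civita (Gamma : chart_index A -> E -> E -> E -> E) : Prop := {
  lc_linear : forall i y, (chart_coord A i @` chart_dom A i) y ->
    forall (k : R) a a' b,
      Gamma i y (k *: a + a') b = k *: Gamma i y a b + Gamma i y a' b;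
  lc_torsion_free : forall i y, (chart_coord A i @` chart_dom A i) y ->
    forall a b, Gamma i y a b = Gamma i y b a;
  lc_metric : forall i y, (chart_coord A i @` chart_dom A i) y -> forall a b c,
    'd (fun z => local_metric i z b c) y a =
      local_metric i y (Gamma i y a b) c + local_metric i y b (Gamma i y a c)
}.

End Riemannian.
End Manifolds.

(** * Oriented Euclidean 3-spaces *)

(* [omega], restricted to the 3-dimensional subspace [P] of [V], is the volume
   form of [P] for the inner product [ip] and the orientation given by the
   direct bases [direct]. *)
Record is_volume_form3 (R : realType) (V : lmodType R) (P : set V)
    (ip : V -> V -> R) (direct : V -> V -> V -> Prop)
    (omega : V -> V -> V -> R) : Prop := {
  vf_linear : forall (k : R) X X' Y Z, P X -> P X' -> P Y -> P Z ->
    omega (k *: X + X') Y Z = k * omega X Y Z + omega X' Y Z;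
  vf_anti12 : forall X Y Z, P X -> P Y -> P Z -> omega Y X Z = - omega X Y Z;
  vf_anti23 : forall X Y Z, P X -> P Y -> P Z -> omega X Z Y = - omega X Y Z;
  vf_normalized : forall X Y Z, P X -> P Y -> P Z ->
    ip X X = 1 -> ip Y Y = 1 -> ip Z Z = 1 ->
    ip X Y = 0 -> ip X Z = 0 -> ip Y Z = 0 ->
    direct X Y Z -> omega X Y Z = 1
}.

(* [a1 /\ a2 /\ a3], with the convention [(a /\ b) X Y = a X * b Y - a Y * b X]. *)
Definition wedge3 (R : realType) (V : Type) (a1 a2 a3 : V -> R) (X Y Z : V) : R :=
  \det (\matrix_(i < 3, j < 3)
    tnth [tuple a1; a2; a3] i (tnth [tuple X; Y; Z] j)).

(** * The unit tangent sphere bundle of an oriented Riemannian 4-manifold *)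

(* An orientation is given by an atlas with orientation-preserving transition
   maps. *)
Definition oriented_atlas (R : realType) (n : nat) (M : Type)
    (A : atlas 'rV[R]_n M) : Prop :=
  forall i j x, chart_dom A i x -> chart_dom A j x ->
    0 < \det ('J (transition i j) (chart_coord A i x)).

Definition rows4 (R : realType) (a b c d : 'rV[R]_4) : 'M[R]_4 :=
  \matrix_(i < 4) tnth [tuple a; b; c; d] i.

(* The preferred charts being direct, so are the vectors of [T_x M] whose
   components have positive determinant. *)
Definition direct4 (R : realType) (a b c d : 'rV[R]_4) : Prop :=
  0 < \det (rows4 a b c d).

Section SphereBundle.
Variables (R : realType) (M : Type).
Local Notation E := 'rV[R]_4.
Variables (A : atlas E M) (g : M -> E -> E -> R).
Variable Gamma : chart_index A -> E -> E -> E -> E.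

Local Notation TM := (M * E)%type.
Local Notation TTM := (E * E)%type.
Local Notation TA := (tangent_atlas A).

(* [sqrt (det g) dx^1 /\ dx^2 /\ dx^3 /\ dx^4] *)
Definition Vol_M (x : M) (a b c d : E) : R :=
  Num.sqrt (\det (\matrix_(i < 4, j < 4) g x 'e_i 'e_j)) * \det (rows4 a b c d).

Definition sphere_bundle : set TM := [set u | g u.1 u.2 u.2 = 1].

(* The projection [f]. *)
Definition foot (u : TM) : M := u.1.

(* [T_u S_M] is the kernel in [T_u TM] of the differential of the function
   [w |-> |w|^2], of which [S_M] is a regular level set. *)
Definition TS (u : TM) : set TTM :=
  [set X | vdiff TA (fun w : TM => g w.1 w.2 w.2) u X = 0].

(* [df X]; this is also [theta X], seen in the copy of [f^* TM] containing the
   vertical bundle. *)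
Definition df (u : TM) (X : TTM) : E := tangent_map TA A foot u X.

(* [X^v = (f^* nabla)_X U]. In the frame of [f^* TM] induced by a chart [i], the
   components of [U] are [fun w => components i w.1 w.2], and
   [(f^* nabla)_X U = dU X + Gamma (df X) U]. *)
Definition vpart (u : TM) (X : TTM) : E :=
  let i := chart_at A u.1 in
  vdiff TA (fun w : TM => components i w.1 w.2) u X
    + Gamma i (chart_coord A i u.1) (df u X) u.2.

Definition SM_metric (u : TM) (X Y : TTM) : R :=
  g u.1 (df u X) (df u Y) + g u.1 (vpart u X) (vpart u Y).

(* Only [e 0], ..., [e 3] are constrained by orthonormality, which implies that
   of [e 4], [e 5], [e 6]. *)
Record adapted_frame (u : TM) (e : {ffun 'I_7 -> TTM}) : Prop := {
  af_tangent : forall i, TS u (e i);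
  af_horizontal : forall i : 'I_7, (i < 4)%N -> vpart u (e i) = 0;
  af_e0 : df u (e (inord 0)) = u.2;
  af_orthonormal : forall i j : 'I_7, (i < 4)%N -> (j < 4)%N ->
    SM_metric u (e i) (e j) = (i == j)%:R;
  af_direct : direct4 (df u (e (inord 0))) (df u (e (inord 1)))
                      (df u (e (inord 2))) (df u (e (inord 3)));
  af_vertical : forall i : 'I_7, (0 < i < 4)%N ->
    df u (e (inord (i + 3))) = 0 /\ vpart u (e (inord (i + 3))) = df u (e i)
}.

(* The value 0 is never used for [u] in [S_M]. *)
Definition some_adapted_frame (u : TM) : {ffun 'I_7 -> TTM} :=
  xget 0 (adapted_frame u).

(* The adapted frame is orthonormal, hence the dual coframe. *)
Definition coframe (u : TM) (i : nat) (X : TTM) : R :=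
  SM_metric u (some_adapted_frame u (inord i)) X.

Definition mu (u : TM) (X : TTM) : R := g u.1 u.2 (df u X).

Definition beta (u : TM) (X Y : TTM) : R :=
  g u.1 (df u X) (vpart u Y) - g u.1 (df u Y) (vpart u X).

Definition mu_wedge_beta (u : TM) (X Y Z : TTM) : R :=
  mu u X * beta u Y Z + mu u Y * beta u Z X + mu u Z * beta u X Y.

Definition alpha (u : TM) (X Y Z : TTM) : R :=
  Vol_M u.1 u.2 (vpart u X) (vpart u Y) (vpart u Z).

(* This does not depend on the adapted frame. *)
Definition alpha2 (u : TM) (X Y Z : TTM) : R :=
  let e := coframe u in
  wedge3 (e 1) (e 2) (e 6) X Y Z + wedge3 (e 2) (e 3) (e 4) X Y Z
    + wedge3 (e 3) (e 1) (e 5) X Y Z.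

Definition phi (u : TM) (X Y Z : TTM) : R :=
  alpha u X Y Z + mu_wedge_beta u X Y Z - alpha2 u X Y Z.

Definition fibre (x : M) : set TM := sphere_bundle `&` foot @^-1` [set x].

Definition fibre_tangent (u : TM) : set TTM := TS u `&` [set X | df u X = 0].

(* Boundary orientation of the unit sphere of [T_x M], outward normal [u] first. *)
Definition fibre_direct (u : TM) (X Y Z : TTM) : Prop :=
  direct4 u.2 (vpart u X) (vpart u Y) (vpart u Z).

(* An oriented 3-dimensional submanifold [N] of [S_M], with tangent spaces [TN]
   and direct bases [direct], is associative if [phi] restricts to its
   Riemannian volume form. *)
Definition associative_submanifold (N : set TM) (TN : TM -> set TTM)
    (direct : TM -> TTM -> TTM -> TTM -> Prop) : Prop :=
  forall u, N u ->
    is_volume_form3 (TN u) (SM_metric u) (direct u) (phi u).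

End SphereBundle.

Arguments associative_submanifold {R M A} g Gamma N TN direct.
Arguments fibre_tangent {R M} A g u.
Arguments fibre_direct {R M A} Gamma u X Y Z.

(* Main.v *)
Require Import Defs.
From mathcomp Require Import all_boot all_order all_algebra.
From mathcomp Require Import all_classical all_reals all_analysis.
From mathcomp Require Import perm ring.

Set Implicit Arguments.
Unset Strict Implicit.
Unset Printing Implicit Defensive.

Import Order.TTheory GRing.Theory Num.Theory.
Import numFieldNormedType.Exports.

Local Open Scope classical_set_scope.
Local Open Scope ring_scope.

(** On vertical vectors the forms [mu] and [e^1, e^2, e^3] vanish, and every term
    of [mu /\ beta] and [alpha_2] contains one of them, so that [phi] restricts to
    [alpha = Vol_M (U, ., ., .)] on the fibres. Differentiating [|w|^2 = 1] along a
    fibre shows that vertical vectors tangent to [S_M] are orthogonal to [U];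
    hence [alpha] is [1] on a direct orthonormal frame of the fibre. *)

(** * Differentials of maps known only near a point *)

(** The first-order expansion at [x] depends only on the germ of the map, and it determines the
    differential. *)
Lemma near_eq_diff (R : numFieldType) (V W : normedModType R) (f h : V -> W)
    (x : V) :
  differentiable f x -> (\forall y \near x, f y = h y) ->
  differentiable h x /\ 'd h x = 'd f x :> (V -> W).
Proof.
move=> df fh.
have cdf : continuous ('d f x) by exact: diff_continuous.
have dh : h \o shift x = cst (h x) + 'd f x +o_ (0 : V) id.
  apply/eqaddoP => eps eps0.
  have /eqaddoP/(_ eps eps0) := diff_locally df.
  have fh' : \forall y \near (0 : V), f (y + x) = h (y + x).
    by move: fh; rewrite (near_shift 0 x); apply: filterS => y; rewrite /= subr0.
  apply: filterS2 fh' => y /= fhy.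
  by rewrite !fctE /= /shift /cst fhy (nbhs_singleton fh).
have dhE : 'd h x = 'd f x :> (V -> W) by exact: diff_unique.
split; last exact: dhE.
by apply/diff_locallyP; rewrite dhE; split.
Qed.

(** Maps read in charts simplify only on the image of a chart; this computes their differentials
    where they reduce to a linear map. *)
Lemma near_diff_linear (R : numFieldType) (V W : normedModType R) (f : V -> W)
    (l : {linear V -> W}) (x : V) :
  continuous l -> (\forall y \near x, f y = l y) -> 'd f x = l :> (V -> W).
Proof.
move=> cl fl.
have [] := near_eq_diff (@linear_differentiable _ _ _ l x cl) (h := f).
  by apply: filterS fl => y ->.
by move=> _ ->; rewrite diff_lin.
Qed.

(** * Bilinear forms and Gram matrices *)

Section BilinearForm.
Variables (R : comNzRingType) (n : nat) (B : 'rV[R]_n -> 'rV[R]_n -> R).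
Hypothesis B_linear : forall k a a' b, B (k *: a + a') b = k * B a b + B a' b.
Hypothesis B_sym : forall a b, B a b = B b a.

Lemma form_sum_delta a b :
  B a b = \sum_i \sum_j a 0 i * b 0 j * B 'e_i 'e_j.
Proof.
(* With zero vectors and coefficient [-1], linearity reads [B 0 c = - B 0 c + B 0 c]. *)
have B0 c : B 0 c = 0.
  by have := B_linear (-1) 0 0 c; rewrite scaler0 addr0 mulN1r addNr.
have BD c : {morph B^~ c : x y / x + y}.
  by move=> x y; have := B_linear 1 x y c; rewrite scale1r mul1r.
have BZ k x c : B (k *: x) c = k * B x c.
  by have := B_linear k x 0 c; rewrite !addr0 B0 addr0.
have Bsum x c : B x c = \sum_i x 0 i * B 'e_i c.
  rewrite {1}[x]row_sum_delta (big_morph _ (BD c) (B0 c)).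
  by apply: eq_bigr => i _; rewrite BZ.
rewrite Bsum; apply: eq_bigr => i _; rewrite B_sym Bsum mulr_sumr.
by apply: eq_bigr => j _; rewrite mulrA B_sym.
Qed.

Lemma gram_matrix m (P : 'M[R]_(m, n)) :
  \matrix_(i, j) B (row i P) (row j P) =
    P *m (\matrix_(i, j) B 'e_i 'e_j) *m P^T.
Proof.
apply/matrixP => i j; rewrite !mxE form_sum_delta exchange_big.
apply: eq_bigr => l _; rewrite !mxE mulr_suml; apply: eq_bigr => k _.
by rewrite !mxE mulrAC.
Qed.

End BilinearForm.

(** * Determinants and alternation *)

(** The first row of the determinant is zero. *)
Lemma wedge3_eq0 (R : realType) (V : Type) (a b c : V -> R) (X Y Z : V) :
  a X = 0 -> a Y = 0 -> a Z = 0 -> wedge3 a b c X Y Z = 0.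
Proof.
move=> aX aY aZ; rewrite /wedge3 (expand_det_row _ ord0) big1 // => j _.
rewrite mxE [X in X * _](_ : _ = 0) ?mul0r //.
by case: j => [[|[|[|//]]] ?].
Qed.

Section Rows4.
Variable R : realType.
Implicit Types a b c d : 'rV[R]_4.

Lemma det_rows4_linear k a b b' c d :
  \det (rows4 a (k *: b + b') c d) = k * \det (rows4 a b c d) + \det (rows4 a b' c d).
Proof.
(* [determinant_multilinear] expects a coefficient in front of both determinants. *)
rewrite -[\det (rows4 a b' c d)]mul1r.
by apply: (determinant_multilinear (i0 := 1)); rewrite ?rowK ?scale1r //;
  apply/matrixP => -[[|[|[|//]]] ?] j; rewrite !mxE.
Qed.

Lemma det_rows4_swap12 a b c d : \det (rows4 a c b d) = - \det (rows4 a b c d).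
Proof.
rewrite (_ : rows4 a c b d = xrow 1 2 (rows4 a b c d)).
  by rewrite xrowE det_mulmx det_perm odd_tperm mulN1r.
apply/matrixP => i j; rewrite !mxE permE /=.
by case: i => [[|[|[|[|//]]]] ?].
Qed.

Lemma det_rows4_swap23 a b c d : \det (rows4 a b d c) = - \det (rows4 a b c d).
Proof.
rewrite (_ : rows4 a b d c = xrow 2 3 (rows4 a b c d)).
  by rewrite xrowE det_mulmx det_perm odd_tperm mulN1r.
apply/matrixP => i j; rewrite !mxE permE /=.
by case: i => [[|[|[|[|//]]]] ?].
Qed.

End Rows4.

(** * Charts and transition maps *)

Section Charts.
Variables (R : realType) (E : normedModType R) (M : topologicalType).
Variables (A : atlas E M) (hM : smooth_manifold A).
Implicit Types (i j : chart_index A) (x : M).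

Local Notation image i := (chart_coord A i @` chart_dom A i).

Lemma param_dom i y : image i y -> chart_dom A i (chart_param A i y).
Proof. by move=> [x ix <-]; rewrite (sm_coordK hM). Qed.

Lemma paramK i y : image i y -> chart_coord A i (chart_param A i y) = y.
Proof. by move=> [x ix <-]; rewrite (sm_coordK hM). Qed.

Lemma near_image i y : image i y -> \forall z \near y, image i z.
Proof. by move=> iy; apply: open_nbhs_nbhs; split=> //; exact: sm_open_image. Qed.

Lemma differentiable_transition i j x :
  chart_dom A i x -> chart_dom A j x ->
  differentiable (transition i j) (chart_coord A i x).
Proof.
move=> ix jx; have [+ _] := sm_transition hM i j 1%N.
by apply; exists x.
Qed.

Lemma diff_transition_id i y : image i y -> 'd (transition i i) y = id :> (E -> E).
Proof.
move=> iy; apply: (@near_diff_linear _ _ _ _ idfun) => [? //|].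
by apply: filterS (near_image iy) => z /paramK.
Qed.

(** Chain rule for two mutually inverse transition maps; their composite is known to be the identity
    only near the point, where both charts are defined. *)
Lemma diff_transitionK i j x v :
  chart_dom A i x -> chart_dom A j x ->
  'd (transition j i) (chart_coord A j x)
     ('d (transition i j) (chart_coord A i x) v) = v.
Proof.
move=> ix jx.
have iy : image i (chart_coord A i x) by exists x.
have tE : transition i j (chart_coord A i x) = chart_coord A j x.
  by rewrite /transition /= (sm_coordK hM).
have dij := differentiable_transition ix jx.
have := differentiable_transition jx ix; rewrite -tE => dji.
have /(congr1 (@^~ v)) /= <- := diff_comp dij dji.
rewrite (@near_diff_linear _ _ _ _ idfun) // => [? //|].
(* Continuity of [chart_param] keeps nearby points in the open domain of [j]. *)
have jp : \forall z \near chart_coord A i x, chart_dom A j (chart_param A i z).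
  apply: (sm_param_continuous hM iy); rewrite (sm_coordK hM) //.
  by apply: open_nbhs_nbhs; split=> //; exact: sm_open_dom.
apply: filterS2 (near_image iy) jp => z iz jz.
by rewrite /transition /= (sm_coordK hM) // paramK.
Qed.

Lemma components_preferred i y v : image i y ->
  components i (chart_param A i y) (to_preferred i y v) = v.
Proof.
move=> iy.
by have := diff_transitionK v (param_dom iy) (sm_chart_at hM _); rewrite paramK.
Qed.

End Charts.

(** * The tangent bundle in preferred charts *)

Section SphereBundle.
Variables (R : realType) (M : topologicalType).
Local Notation E := 'rV[R]_4.
Variables (A : atlas E M) (g : M -> E -> E -> R).
Variable Gamma : chart_index A -> E -> E -> E -> E.
Hypotheses (hM : smooth_manifold A) (hg : riemannian_metric A g)
  (hGamma : levi_civita g Gamma).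

Local Notation TM := (M * E)%type.
Local Notation TTM := (E * E)%type.
Local Notation TA := (tangent_atlas A).
Local Notation chart u := (chart_at A u.1).
Local Notation coord u := (chart_coord A (chart u) u.1).
Implicit Types (u : TM) (X Y Z : TTM).

Lemma coord_image u : (chart_coord A (chart u) @` chart_dom A (chart u)) (coord u).
Proof. by exists u.1 => //; exact: sm_chart_at. Qed.

Lemma tangent_coord u :
  chart_coord TA (chart_at TA u) u = (coord u, u.2).
Proof. by rewrite /= /components diff_transition_id //; exact: coord_image. Qed.

Lemma near_coord_image u : \forall p \near (coord u, u.2),
  (chart_coord A (chart u) @` chart_dom A (chart u)) p.1.
Proof. by apply: cvg_fst; exact: near_image (coord_image u). Qed.

(** Read in preferred charts, the projection [foot] is [fst]. *)
Lemma dfE u X : df A u X = X.1.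
Proof.
rewrite /df /tangent_map /vdiff tangent_coord.
rewrite (@near_diff_linear _ _ _ _ fst) //; first by move=> ?; exact: cvg_fst.
by apply: filterS (near_coord_image u) => p /= /(paramK hM).
Qed.

(** Read in the preferred chart, the tautological section is [snd]; what remains is the coordinate
    formula for the covariant derivative. *)
Lemma vpartE u X :
  vpart Gamma u X = X.2 + Gamma (chart u) (coord u) X.1 u.2.
Proof.
rewrite /vpart dfE /vdiff tangent_coord; congr (_ + _).
rewrite (@near_diff_linear _ _ _ _ snd) //; first by move=> ?; exact: cvg_snd.
by apply: filterS (near_coord_image u) => p /= /(components_preferred hM).
Qed.

(** * Orthogonality of the fibre to the tautological section *)

(** [rm_smooth] concerns fixed vectors; this expansion turns it into joint differentiability in the
    point and the vector. *)
Lemma local_metric_sum (i : chart_index A) (y a b : E) : local_metric g i y a b =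
  \sum_j \sum_k a 0 j * b 0 k * local_metric g i y 'e_j 'e_k.
Proof.
apply: (form_sum_delta (B := local_metric g i y)) => [k c c' d|c d].
  by rewrite /local_metric /to_preferred linearP (rm_linear hg).
exact: (rm_sym hg).
Qed.

Lemma differentiable_norm_sq (i : chart_index A) (y v : E) : (chart_coord A i @` chart_dom A i) y ->
  differentiable (fun p : TTM => local_metric g i p.1 p.2 p.2 : R) (y, v).
Proof.
move=> iy.
rewrite (_ : (fun _ => _) = \sum_j \sum_k (fun p : TTM =>
   p.2 0 j * p.2 0 k * local_metric g i p.1 'e_j 'e_k)); last first.
  apply/funext => p; rewrite local_metric_sum fct_sumE.
  by apply: eq_bigr => j _; rewrite fct_sumE.
have dsnd j : differentiable (fun p : TTM => p.2 0 j : R) (y, v).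
  apply: (@differentiable_comp _ _ _ _ snd (fun w : E => w 0 j : R)).
    by apply: linear_differentiable => ?; exact: cvg_snd.
  exact: differentiable_coord.
apply: differentiable_sum => j; apply: differentiable_sum => k.
apply: differentiableM; first by apply: differentiableM; exact: dsnd.
apply: (@differentiable_comp _ _ _ _ fst
  (fun z : E => local_metric g i z 'e_j 'e_k)).
  by apply: linear_differentiable => ?; exact: cvg_fst.
by have [+ _] := rm_smooth hg i 'e_j 'e_k 1%N; apply.
Qed.

(** In the chart a vertical [X] moves only the vector, so the derivative of the squared norm along
    it is twice the product wanted; tangency to the sphere bundle makes it zero. *)
Lemma vertical_orthogonal u X :
  TS A g u X -> df A u X = 0 -> g u.1 u.2 (vpart Gamma u X) = 0.
Proof.
rewrite /TS /= /vdiff tangent_coord vpartE dfE => + X1.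
set i := chart u; set y := coord u.
have iy := coord_image u.
have -> : (fun w : TM => g w.1 w.2 w.2) \o chart_param TA i =
  (fun p : TTM => local_metric g i p.1 p.2 p.2) by [].
rewrite -deriveE; last exact: differentiable_norm_sq.
have -> : Gamma i y X.1 u.2 = 0.
  have := lc_linear hGamma iy (-1) 0 0 u.2.
  by rewrite X1 scaler0 addr0 scaleN1r addNr.
rewrite addr0 /derive.
have gE a b : local_metric g i y a b = g u.1 a b.
  rewrite /local_metric /to_preferred /y (sm_coordK hM); last exact: sm_chart_at.
  by rewrite diff_transition_id.
have gl := rm_linear hg; have gs := rm_sym hg.
set D := fun h : R => _.
(* The difference quotient [D] is affine in [h] away from [0], so its limit is the constant term. *)
have DE : \forall h \near 0^', 2 * g u.1 u.2 X.2 + h * g u.1 X.2 X.2 = D h.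
  near=> h.
  have h0 : h != 0 by near: h; exact: nbhs_dnbhs_neq.
  rewrite /D /= X1 scaler0 add0r !gE !(gl, gs _ _ (_ + _)) (gs _ X.2 u.2).
  apply: (mulfI h0); rewrite -[X in _ = _ * X]/(_ * _) mulVKf //.
  ring.
have Dcvg : D h @[h --> 0^'] --> 2 * g u.1 u.2 X.2.
  apply: (@cvg_trans _ ((2 * g u.1 u.2 X.2 + h * g u.1 X.2 X.2) @[h --> 0^'])).
    exact: near_eq_cvg DE.
  suff : (2 * g u.1 u.2 X.2 + h * g u.1 X.2 X.2) @[h --> 0^'] -->
      2 * g u.1 u.2 X.2 + 0 * g u.1 X.2 X.2 by rewrite mul0r addr0.
  apply: cvgD; first exact: cvg_cst.
  by apply: cvgMl; exact: cvg_within.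
rewrite (cvg_lim (@Rhausdorff R) Dcvg) => /eqP.
by rewrite mulf_eq0 pnatr_eq0 => /eqP.
Unshelve. all: by end_near. Qed.

(** * Restriction of [phi] to vertical vectors *)

Lemma vpart_linear u k X X' :
  vpart Gamma u (k *: X + X') = k *: vpart Gamma u X + vpart Gamma u X'.
Proof.
rewrite !vpartE /= (lc_linear hGamma (coord_image u)) scalerDr -!addrA.
by congr (_ + _); rewrite addrCA.
Qed.

Lemma vpart0 u : vpart Gamma u 0 = 0.
Proof.
by have := vpart_linear u (-1) 0 0; rewrite scaler0 addr0 scaleN1r addNr.
Qed.

Lemma metric0l x a : g x 0 a = 0.
Proof.
by have := rm_linear hg x (-1) 0 0 a; rewrite scaler0 addr0 mulN1r addNr.
Qed.

Lemma metric0r x a : g x a 0 = 0.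
Proof. by rewrite (rm_sym hg) metric0l. Qed.

Lemma SM_metric_vertical u X Y : df A u X = 0 ->
  SM_metric g Gamma u X Y = g u.1 (vpart Gamma u X) (vpart Gamma u Y).
Proof. by rewrite /SM_metric => ->; rewrite metric0l add0r. Qed.

(* This holds whether or not an adapted frame exists: otherwise the chosen frame
   is [0], and so is the coframe. *)
Lemma coframe_vertical u (i : nat) X :
  (i < 4)%N -> df A u X = 0 -> coframe g Gamma u i X = 0.
Proof.
move=> i4 dX; rewrite /coframe /SM_metric dX metric0r add0r.
suff -> : vpart Gamma u (some_adapted_frame g Gamma u (inord i)) = 0.
  by rewrite metric0l.
rewrite /some_adapted_frame; case: xgetP => [e _ ae|_].
  by apply: (af_horizontal ae); rewrite inordK // (leq_trans i4).
by rewrite ffunE vpart0.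
Qed.

Lemma phi_vertical u X Y Z :
  df A u X = 0 -> df A u Y = 0 -> df A u Z = 0 ->
  phi g Gamma u X Y Z = alpha g Gamma u X Y Z.
Proof.
move=> dX dY dZ; rewrite /phi /mu_wedge_beta /mu dX dY dZ metric0r !mul0r !addr0.
rewrite /alpha2.
(* Each term of [alpha2] is written with one of [e 1], [e 2], [e 3] as its first factor. *)
rewrite !wedge3_eq0 ?coframe_vertical //.
by rewrite !addr0 subr0.
Qed.

(** * The volume form of a fibre *)

(** With [P] the matrix of the frame and [G] that of the metric, orthonormality says
    [P *m G *m P^T = 1%:M]. Hence [\det G] is the inverse square of [\det P], and positivity of
    [\det P] fixes the sign of the square root. *)
Lemma Vol_M_orthonormal x a b c d :
  g x a a = 1 -> g x b b = 1 -> g x c c = 1 -> g x d d = 1 ->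
  g x a b = 0 -> g x a c = 0 -> g x a d = 0 ->
  g x b c = 0 -> g x b d = 0 -> g x c d = 0 ->
  direct4 a b c d -> Vol_M g x a b c d = 1.
Proof.
move=> aa bb cc dd ab ac ad bc bd cd; rewrite /direct4 /Vol_M.
set P := rows4 a b c d; set G := (\matrix_(i, j) _) => P0.
have gs := rm_sym hg x.
have : P *m G *m P^T = 1%:M.
  rewrite -(gram_matrix (rm_linear hg x) gs); apply/matrixP => i j.
  rewrite !mxE !rowK.
  by case: i => [[|[|[|[|//]]]] ?]; case: j => [[|[|[|[|//]]]] ?];
    rewrite !(tnth_nth 0) //= gs.
move=> /(congr1 determinant); rewrite !det_mulmx det_tr det1 => PGP.
have -> : \det G = (\det P)^-1 ^+ 2.
  apply: (mulfI (lt0r_neq0 P0)); apply: (mulIf (lt0r_neq0 P0)); rewrite PGP.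
  by field; exact: lt0r_neq0.
by rewrite sqrtr_sqr ger0_norm ?invr_ge0 ?ltW // mulVf // lt0r_neq0.
Qed.

Lemma fibre_volume_form u : g u.1 u.2 u.2 = 1 ->
  is_volume_form3 (fibre_tangent A g u) (SM_metric g Gamma u)
    (fibre_direct Gamma u) (phi g Gamma u).
Proof.
move=> u1; split.
- move=> k X X' Y Z [_ dX] [_ dX'] [_ dY] [_ dZ].
  have dXX' : df A u (k *: X + X') = 0.
    by move: dX dX'; rewrite /= !dfE /= => -> ->; rewrite scaler0 addr0.
  rewrite !phi_vertical // /alpha /Vol_M vpart_linear det_rows4_linear.
  by rewrite mulrDr mulrCA.
- move=> X Y Z [_ dX] [_ dY] [_ dZ].
  by rewrite !phi_vertical // /alpha /Vol_M det_rows4_swap12 mulrN.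
- move=> X Y Z [_ dX] [_ dY] [_ dZ].
  by rewrite !phi_vertical // /alpha /Vol_M det_rows4_swap23 mulrN.
- move=> X Y Z [tX dX] [tY dY] [tZ dZ].
  rewrite !SM_metric_vertical // phi_vertical // => XX YY ZZ XY XZ YZ dir.
  (* The unit vector [u.2] completes the three vertical parts to a direct orthonormal frame of the
     tangent space of [M]. *)
  by apply: Vol_M_orthonormal => //; exact: vertical_orthogonal.
Qed.

End SphereBundle.

Theorem mainTheorem3 (R : realType) (M : topologicalType)
    (A : atlas 'rV[R]_4 M) (g : M -> 'rV[R]_4 -> 'rV[R]_4 -> R)
    (Gamma : chart_index A -> 'rV[R]_4 -> 'rV[R]_4 -> 'rV[R]_4 -> 'rV[R]_4)
    (hM : smooth_manifold A) (hO : oriented_atlas A)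
    (hg : riemannian_metric A g) (hGamma : levi_civita g Gamma) :
  forall x : M,
    associative_submanifold g Gamma (fibre g x) (fibre_tangent A g) (fibre_direct Gamma).
Proof. by move=> x u [u1 _]; exact: fibre_volume_form. Qed.
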